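(* Let $A=(1,a_1,\ldots,a_k)$ be an orderly currency with $k\geq 3$, $a_2>2a_1$ and $a_3>2a_2$. Then the currency $(1,a_1,a_2,a_l)$ is orderly for every $4\leq l\leq k$.
   Context: A currency is a finite sequence of integers $A=(a_0,a_1,\ldots,a_k)$ with $1=a_0<a_1<\cdots<a_k$. For an integer amount $c>0$, $\mathrm{opt}_A(c)$ is the minimum number of coins (values from $A$, repetitions allowed) summing to $c$, and $\mathrm{grd}_A(c)$ is the number of coins used by the greedy algorithm, which repeatedly takes the largest coin not exceeding the remaining amount. $A$ is orderly if $\mathrm{opt}_A(c)=\mathrm{grd}_A(c)$ for all integers $c>0$. *)

(* Defs.v *)
From mathcomp Require Import all_boot.

Set Implicit Arguments.
Unset Strict Implicit.
Unset Printing Implicit Defensive.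

(* A currency (a_0, ..., a_k) is the sequence [:: a_0; ...; a_k], so that
   a_i = nth 0 A i and size A = k.+1. *)
Definition currency (A : seq nat) : bool :=
  (head 0 A == 1) && sorted ltn A.

(* m i is the number of coins of value a_i; the bound m i <= c loses nothing
   because every coin is at least 1. *)
Definition pays (A : seq nat) (c : nat)
    (m : {ffun 'I_(size A) -> 'I_c.+1}) : bool :=
  \sum_(i < size A) m i * nth 0 A i == c.

(* The default value c of the minimum is the number of coins of the payment
   made of unit coins only, which is available in every currency. *)
Definition opt (A : seq nat) (c : nat) : nat :=
  \big[minn/c]_(m : {ffun 'I_(size A) -> 'I_c.+1} | pays m)
     \sum_(i < size A) m i.

Definition greedy_coin (A : seq nat) (c : nat) : nat :=
  \max_(a <- A | a <= c) a.

(* Each greedy coin is at least 1 in a currency, so c steps suffice to pay c. *)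
Fixpoint grd_rec (A : seq nat) (fuel c : nat) : nat :=
  if fuel is n.+1 then
    if c == 0 then 0 else (grd_rec A n (c - greedy_coin A c)).+1
  else 0.

Definition grd (A : seq nat) (c : nat) : nat := grd_rec A c c.

Definition orderly (A : seq nat) : Prop :=
  forall c : nat, 0 < c -> opt A c = grd A c.

(* Main.v *)
Require Import Defs.
From mathcomp Require Import all_boot.
From mathcomp Require Import zify.

(* Write a, b, t for the second, third and fourth coin.  In an orderly
   currency the greedy remainder of a sum of two coins is 0 or a coin, and this
   forces any two coins above b to differ by at least t - b > b.  Hence for the
   least multiple m * b >= a_l, which is below a_l + b, the greedy algorithm of
   A takes a_l first and then uses only 1 and a, so that
   1 + grd (m * b - a_l) <= m; by the one-point theorem (1, a, b, a_l) is
   orderly. *)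

(** * Greedy and optimal payments as lists of coins *)

Section Currency.

Variable A : seq nat.
Hypothesis hcur : currency A.
Implicit Types (c x : nat) (s : seq nat).

Lemma currency_sorted : sorted ltn A.
Proof. by case/andP: hcur. Qed.

Lemma currency_uniq : uniq A.
Proof. exact: (sorted_uniq ltn_trans ltnn currency_sorted). Qed.

Lemma currency_mem1 : 1 \in A.
Proof. by case: A hcur => [|x B] //= /andP[/= /eqP-> _]; rewrite mem_head. Qed.

Lemma currency_gt0 x : x \in A -> 0 < x.
Proof.
case: A hcur => [|y B] //= /andP[/= /eqP-> hB]; rewrite inE => /predU1P[->//|xB].
by have /allP/(_ x xB)/= := order_path_min ltn_trans hB; apply: leq_ltn_trans.
Qed.

Lemma greedy_coin_ge c x : x \in A -> x <= c -> x <= greedy_coin A c.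
Proof. by move=> xA xc; rewrite /greedy_coin (leq_bigmax_seq (F := id)). Qed.

Lemma greedy_coin_eq c x :
  x \in A -> x <= c -> (forall y, y \in A -> y <= c -> y <= x) ->
  greedy_coin A c = x.
Proof.
move=> xA xc xmax; apply/eqP; rewrite eqn_leq greedy_coin_ge // andbT.
by apply/bigmax_leqP_seq => y yA yc; apply: xmax.
Qed.

Lemma greedy_coin_gt0 c : 0 < c -> 0 < greedy_coin A c.
Proof. exact: greedy_coin_ge currency_mem1. Qed.

Lemma greedy_coin_mem c :
  0 < c -> (greedy_coin A c \in A) && (greedy_coin A c <= c).
Proof.
move=> c0; have := greedy_coin_gt0 _ c0; rewrite /greedy_coin big_seq_cond.
apply: (@big_ind _ (fun v => 0 < v -> (v \in A) && (v <= c))) => // x y hx hy.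
by rewrite /maxn; case: ifP.
Qed.

Lemma grd_rec_fuel n c : c <= n -> grd_rec A n c = grd A c.
Proof.
elim/ltn_ind: n c => [[|n]] IH c; first by rewrite leqn0 => /eqP->.
move=> cn; rewrite /grd; case: c cn => // c cn; rewrite /=.
have h := greedy_coin_gt0 _ (ltn0Sn c).
by congr S; rewrite !IH //; lia.
Qed.

Lemma grd0 : grd A 0 = 0. Proof. by []. Qed.

Lemma grd_step c : 0 < c -> grd A c = (grd A (c - greedy_coin A c)).+1.
Proof.
case: c => // c _; rewrite {1}/grd /= grd_rec_fuel //.
have := greedy_coin_gt0 _ (ltn0Sn c); lia.
Qed.

Lemma grd_max_coin c x :
  x \in A -> x <= c -> (forall y, y \in A -> y <= c -> y <= x) ->
  grd A c = (grd A (c - x)).+1.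
Proof.
move=> xA xc xmax; rewrite grd_step ?(greedy_coin_eq c x) //.
exact: leq_trans (currency_gt0 x xA) xc.
Qed.

Lemma grd_payment c :
  exists s, [/\ {subset s <= A}, sumn s = c & size s = grd A c].
Proof.
elim/ltn_ind: c => -[|c] IH; first by exists [::].
have /andP[gA gc] := greedy_coin_mem _ (ltn0Sn c).
have g0 := greedy_coin_gt0 _ (ltn0Sn c).
have [|s [sA ss sz]] := IH (c.+1 - greedy_coin A c.+1); first by lia.
exists (greedy_coin A c.+1 :: s); split; rewrite /= ?ss ?sz -?grd_step ?subnKC //.
by move=> x; rewrite inE => /predU1P[->|/sA].
Qed.

(** Links lists of coins to the multiplicity vectors of [pays]: [f = id] gives the amount, [f = 1]
    the number of coins. *)
Lemma sum_count_mem (f : nat -> nat) s :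
  {subset s <= A} ->
  \sum_(i < size A) count_mem (nth 0 A i) s * f (nth 0 A i) =
  \sum_(x <- s) f x.
Proof.
rewrite -(big_mkord xpredT (fun i => count_mem (nth 0 A i) s * f (nth 0 A i))).
rewrite -(big_nth 0 xpredT (fun x => count_mem x s * f x)).
elim: s => [|y s IH] sA; first by rewrite big_nil big1.
rewrite big_cons -IH => [|x xs]; last by rewrite sA // inE xs orbT.
under eq_bigr => x _ do rewrite /= mulnDl.
rewrite big_split /= (bigD1_seq y) ?currency_uniq ?sA ?mem_head //= eqxx mul1n.
by rewrite big1 ?addn0 // => x; rewrite eq_sym => /negPf->.
Qed.

Lemma opt_le s : {subset s <= A} -> opt A (sumn s) <= size s.
Proof.
move=> sA; rewrite /opt.
have sz x : count_mem x s < (sumn s).+1.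
  rewrite ltnS (leq_trans (count_size _ _)) //; elim: s sA => //= y s IH sA.
  have := currency_gt0 y (sA _ (mem_head _ _)).
  suff: size s <= sumn s by lia.
  by apply: IH => z zs; rewrite sA // inE zs orbT.
pose m := [ffun i : 'I_(size A) => Ordinal (sz (nth 0 A i))].
have pm : pays m.
  apply/eqP; rewrite [RHS]sumnE -(sum_count_mem id) //.
  by apply: eq_bigr => i _; rewrite ffunE.
have -> : size s = \sum_(i < size A) m i.
  rewrite -sum1_size -(sum_count_mem (fun=> 1)) //.
  by apply: eq_bigr => i _; rewrite ffunE muln1.
have : m \in index_enum {ffun 'I_(size A) -> 'I_(sumn s).+1}.
  by rewrite mem_index_enum.
elim: (index_enum _) => //= m' r IH; rewrite inE big_cons => /predU1P[<-|/IH].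
  by rewrite pm geq_minl.
by case: ifP => // _; apply: leq_trans (geq_minr _ _).
Qed.

Lemma opt_payment c :
  exists s, [/\ {subset s <= A}, sumn s = c & size s = opt A c].
Proof.
rewrite /opt; elim/big_ind: _ => [|x y hx hy|m /eqP hm].
- exists (nseq c 1); rewrite sumn_nseq mul1n size_nseq; split=> // x.
  by rewrite mem_nseq => /andP[_ /eqP->]; apply: currency_mem1.
- by rewrite /minn; case: ifP.
exists (flatten [seq nseq (m i) (nth 0 A i) | i : 'I_(size A)]).
rewrite sumn_flatten size_flatten /shape -!map_comp !sumnE !big_map -!enumT !big_enum /=.
split.
- by move=> x /flatten_mapP[i _]; rewrite mem_nseq => /andP[_ /eqP->]; rewrite mem_nth.
- by rewrite -[RHS]hm; apply: eq_bigr => i _; rewrite sumn_nseq mulnC.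
- by apply: eq_bigr => i _; rewrite size_nseq.
Qed.

(** Replaces [opt] by arbitrary lists of coins: greedy and optimal payments are such lists, and
    [opt] bounds them all from below. *)
Lemma orderlyP :
  orderly A <-> forall s, {subset s <= A} -> grd A (sumn s) <= size s.
Proof.
split=> [hord s sA|h c c0].
  have [->|s0] := posnP (sumn s); first by rewrite grd0.
  by rewrite -hord // opt_le.
apply/eqP; rewrite eqn_leq; apply/andP; split.
  by have [s [sA <- <-]] := grd_payment c; apply: opt_le.
by have [s [sA <- <-]] := opt_payment c; apply: h.
Qed.

Lemma grdD : orderly A ->
  forall c c', grd A (c + c') <= grd A c + grd A c'.
Proof.
move=> /orderlyP hord c c'.
have [s [sA <- <-]] := grd_payment c; have [s' [sA' <- <-]] := grd_payment c'.
rewrite -sumn_cat -size_cat; apply: hord => x.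
by rewrite mem_cat => /orP[/sA|/sA'].
Qed.

(** Two coins suffice, so greedy uses at most two; the first is [z], leaving at most one coin. *)
Lemma orderly_sum2 x y z :
  orderly A -> x \in A -> y \in A -> z \in A -> z <= x + y ->
  (forall u, u \in A -> u <= x + y -> u <= z) ->
  x + y = z \/ exists2 w, w \in A & x + y = z + w.
Proof.
move=> /orderlyP hord xA yA zA zxy zmax.
have : grd A (sumn [:: x; y]) <= 2.
  by apply: hord => u; rewrite !inE => /orP[]/eqP->.
rewrite /= addn0 (grd_max_coin _ z) // ltnS.
have [|r0] := posnP (x + y - z); first by left; lia.
rewrite grd_step // ltnS leqn0 => /eqP h; right.
have /andP[gA gle] := greedy_coin_mem _ r0.
exists (greedy_coin A (x + y - z)) => //.
have [|r1] := posnP (x + y - z - greedy_coin A (x + y - z)); first by lia.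
by move: h; rewrite grd_step.
Qed.

End Currency.

Lemma grd_eq_mem A B c :
  currency A -> currency B -> (forall x, x <= c -> (x \in A) = (x \in B)) ->
  grd A c = grd B c.
Proof.
move=> hA hB; elim/ltn_ind: c => -[|c] IH // hAB.
have /andP[gB gc] := greedy_coin_mem _ hB _ (ltn0Sn c).
rewrite (grd_step _ hB) // (@grd_max_coin _ hA _ (greedy_coin B c.+1)) ?hAB //.
  have := greedy_coin_gt0 _ hB _ (ltn0Sn c) => g0.
  by congr S; apply: IH => [|x xc]; [|apply: hAB]; lia.
by move=> y yA yc; apply: greedy_coin_ge; rewrite // -hAB.
Qed.

(** * Gaps between the large coins *)

Local Ltac arith :=
  repeat match goal with
  | H : is_true (_ \in _) |- _ => clear H
  | H : forall _ : nat, _ |- _ => clear H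
  end; lia.

(* Let x be the least coin above b that has a coin x' closer than t - b above
   it, and let P be the last coin whose next coin P' is closer than x - a, say
   P' = P + h.  For y = b, t, x, x' with h <= y < h + (x - a), greedy pays
   P + y with P' first, so y - h is 0 or a coin.  This forces h = t - b and
   yields a coin Q in (P', P + x']; then greedy pays P + x' and P' + x' with Q
   first, and the remainders would be at most 1 and then t - b or t - b + 1,
   which lies strictly between b and t. *)
Lemma orderly_gap A a b t :
  currency A -> orderly A -> a \in A -> b \in A -> t \in A ->
  1 < a -> 2 * a < b -> 2 * b < t ->
  (forall x, x \in A -> [\/ x = 1, x = a, x = b | t <= x]) ->
  forall x x', x \in A -> x' \in A -> t <= x -> x < x' -> x + t <= x' + b.
Proof.
move=> hcur hord aA bA tA a1 ab bt hA.
pose near d x := has (fun x' => (x < x') && (x' < x + d)) A.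
have nearI d x x' : x' \in A -> x < x' -> x' < x + d -> near d x.
  by move=> x'A h1 h2; apply/hasP; exists x'; rewrite // h1.
suff gap x : x \in A -> t <= x -> ~~ near (t - b) x.
  move=> x x' xA x'A tx xx'; rewrite leqNgt; apply/negP => h.
  by have /negP[] := gap x xA tx; apply: nearI xx' _; first by []; arith.
elim/ltn_ind: x => x IH xA tx; apply/negP => /hasP[x' x'A /andP[xx' x'x]].
(* Minimality of [x], extended to [y = b], whose next coin is at least [t]. *)
have xmin y y' : y \in A -> y' \in A -> b <= y -> y < x -> y < y' ->
    y + t <= y' + b.
  move=> yA y'A bey ylx yy'.
  have [||->|ty] := hA y yA; try arith.
    by have [||?|?] := hA y' y'A; arith.
  rewrite leqNgt; apply/negP => h.
  by have /negP[] := IH y ylx yA ty; apply: nearI yy' _; first by []; arith.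
have [w ex] : exists w, x = a + w by exists (x - a); arith.
have [d et] : exists d, t = b + d by exists (t - b); arith.
have exP : exists P, (P \in A) && near w P.
  by exists x; rewrite xA; apply: nearI xx' _ => //; arith.
have bdP P : (P \in A) && near w P -> P <= \max_(i <- A) i.
  by case/andP=> PA _; rewrite (leq_bigmax_seq (F := id)).
case: (ex_maxnP exP bdP) => P /andP[PA /hasP[P' P'A /andP[PP' P'P]]] Pmax.
have far y y' : y \in A -> y' \in A -> P < y -> y < y' -> y + w <= y'.
  move=> yA y'A Py yy'; rewrite leqNgt; apply/negP => h.
  by have := Pmax y; rewrite yA (nearI _ _ _ y'A) // leqNgt Py => /(_ isT).
have [h eP'] : exists h, P' = P + h by exists (P' - P); arith.
(* The coin after [P'] is at least [P' + w], so greedy pays [P + y] with [P'] first, leaving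
   [y - h]. *)
have hsub y : y \in A -> h <= y -> y < h + w ->
    y = h \/ exists2 z, z \in A & y = h + z.
  move=> yA h1 h2.
  have [|u uA hu|/eqP|[z zA /eqP]] := orderly_sum2 _ hcur P y P' hord PA yA P'A.
  - by rewrite eP' leq_add2l.
  - rewrite leqNgt; apply/negP => Pu; have := far P' u P'A uA PP' Pu.
    by rewrite eP'; arith.
  - by rewrite eP' eqn_add2l => /eqP; left.
  - by rewrite eP' -addnA eqn_add2l => /eqP ->; right; exists z.
clear exP bdP Pmax.
(* Otherwise [b - h] would be a coin strictly between [a] and [b]. *)
have ah : a < h.
  rewrite ltnNge; apply/negP => ha.
  by have [||?|[z /hA[]]] := hsub b bA; arith.
have dh : d <= h.
  have [ht|th] := ltnP h t; last by arith.
  by have [||?|[z /hA[]]] := hsub t tA; arith.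
have hw : h < w by arith.
(* Subtracting [h] from [x] and [x'] would give coins [z] and [z'] less than [t - b] apart, with
   [b <= z < x] because [0 < h < w]; this contradicts [xmin]. *)
have contra_x : ~ (x' = h \/ exists2 z, z \in A & x' = h + z).
  have [||?|[z zA ez]] := hsub x xA; try arith.
  case=> [?|[z' z'A ez']]; first by arith.
  have bz : b <= z by have [?|?|?|?] := hA z zA; arith.
  by have := xmin z z' zA z'A bz; arith.
have x'h : h + w <= x'.
  rewrite leqNgt; apply/negP => hx'.
  by apply/contra_x/hsub => //; arith.
(* From [h + w <= x' < x + d] follows [h < d + a], so the coin [t - h] exceeds [b - a > a] and can
   only be [b]. *)
have eqh : h = d.
  by have [||?|[z /hA[]]] := hsub t tA; arith.
(* Without such a [Q], greedy pays [P + x'] with [P'] first, leaving [x' - h], which [contra_x]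
   forbids. *)
have [/hasP[Q QA /andP[PQ QP]]|noQ] :=
    boolP (has (fun Q => (P' < Q) && (Q <= P + x')) A); last first.
  case: contra_x.
  have [|u uA hu|e|[z zA e]] := @orderly_sum2 A hcur P x' P' hord PA x'A P'A.
  - by arith.
  - rewrite leqNgt; apply: contra noQ => Pu.
    by apply/hasP; exists u; rewrite // Pu.
  - by left; arith.
  - by right; exists z => //; arith.
have hQ := far P' Q P'A QA PP' PQ.
have Qmax y u : P + y < Q + w -> u \in A -> u <= P + y -> u <= Q.
  move=> hy uA hu; rewrite leqNgt; apply/negP => Qu.
  have PQ' : P < Q by arith.
  by have := far Q u QA uA PQ' Qu; arith.
(* The remainder is at most [x' - h - w], which is below [a]; the only coin below [a] is 1. *)
have v1 : P + x' <= Q + 1.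
  have [|u uA hu|?|[z /hA[]]] := @orderly_sum2 A hcur P x' Q hord PA x'A QA; try arith.
  by apply: Qmax uA hu; arith.
have [|u uA||[z /hA[]]] := @orderly_sum2 A hcur P' x' Q hord P'A x'A QA; try arith.
by rewrite eP' -addnA => hu; apply: Qmax uA hu; arith.
Qed.

(** * Appending a new largest coin *)

Lemma grd_addl_max A x c :
  currency A -> x \in A -> (forall y, y \in A -> y <= x) ->
  forall m, grd A (m * x + c) = m + grd A c.
Proof.
move=> hcur xA xmax; elim=> [|m IH]; first by rewrite add0n.
rewrite (grd_max_coin _ hcur _ x) //; last by move=> y yA _; apply: xmax.
  by rewrite mulSn -addnA addKn IH addSn.
by rewrite mulSn -addnA leq_addr.
Qed.

(* The sufficient condition of the one-point theorem of Magazine, Nemhauser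
   and Trotter. *)
Lemma orderly_rcons A p q m :
  currency A -> orderly A -> p \in A -> (forall x, x \in A -> x <= p) ->
  currency (rcons A q) -> p < q -> q <= m * p -> grd A (m * p - q) < m ->
  orderly (rcons A q).
Proof.
move=> hA oA pA pmax hB pq qm hm; set B := rcons A q.
have qB : q \in B by rewrite mem_rcons mem_head.
have BP y : y \in B -> y = q \/ y \in A.
  by rewrite mem_rcons inE => /predU1P.
have qmax y : y \in B -> y <= q.
  by move=> /BP[->|/pmax yp] //; apply: leq_trans yp (ltnW pq).
have grdBq c : grd B (q + c) = (grd B c).+1.
  by have := grd_addl_max B q c hB qB qmax 1; rewrite mul1n.
(* Subadditivity at [q + c] and [m * p - q], whose sum [m * p + c] costs [m] more than [c]. *)
have grdAq c : grd A c < grd A (q + c).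
  have := grdD A hA oA (q + c) (m * p - q).
  have -> : q + c + (m * p - q) = m * p + c by lia.
  by rewrite (grd_addl_max A p) //; lia.
(* Below [q] the two greedy counts agree. From [q] on, removing [q] lowers the count of [B] by
   exactly one and that of [A] by at least one. *)
have grdBA c : grd B c <= grd A c.
  elim/ltn_ind: c => c IH; have [cq|qc] := ltnP c q.
    rewrite leq_eqVlt; apply/orP; left; apply/eqP/grd_eq_mem => // x xc.
    by rewrite mem_rcons inE; case: eqP => [xq|]; first by lia.
  rewrite -(subnKC qc) grdBq; apply: leq_ltn_trans (grdAq _).
  by apply: IH; lia.
apply/(orderlyP B hB) => s sB.
(* [u] collects the old coins met in [s], while each [q] is stripped at once because greedy takes it
   first. At the end only old coins remain and [grdBA] applies. *)
suff: forall u : seq nat, {subset u <= A} -> grd B (sumn s + sumn u) <= size s + size u.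
  by move=> /(_ [::]); rewrite /= !addn0; apply.
elim: s sB => [|y s IH] sB u uA /=.
  by apply: leq_trans (grdBA _) _; move/(orderlyP A hA): oA => /(_ u uA).
have {}IH := IH (fun x xs => sB x (@mem_behead _ (y :: s) x xs)).
have [->|yA] := BP y (sB y (mem_head y s)).
  by rewrite -addnA grdBq addSn ltnS; apply: IH.
rewrite -addnA addnCA addSnnS; apply: (IH (y :: u)) => x.
by rewrite inE => /predU1P[->//|/uA].
Qed.

(** * Building the four-coin currency one coin at a time *)

Lemma currency_nth_lt A i j :
  currency A -> i < j -> j < size A -> nth 0 A i < nth 0 A j.
Proof.
move=> hA ij jA; rewrite (sorted_ltn_nth ltn_trans) ?inE //.
  exact: currency_sorted.
exact: ltn_trans jA.
Qed.

Theorem theorem7p7 (A : seq nat) (k : nat)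
    (hcur : currency A) (hsize : size A = k.+1) (hord : orderly A)
    (hk : 3 <= k)
    (h2 : 2 * nth 0 A 1 < nth 0 A 2)
    (h3 : 2 * nth 0 A 2 < nth 0 A 3) :
  forall l : nat, 4 <= l <= k ->
    orderly [:: 1; nth 0 A 1; nth 0 A 2; nth 0 A l].
Proof.
move=> l /andP[l4 lk].
have lt_nth i j : i < j -> j <= k -> nth 0 A i < nth 0 A j.
  by move=> ij jk; apply: currency_nth_lt; rewrite ?hsize.
have A0 : nth 0 A 0 = 1.
  by case: A hcur {hsize hord h2 h3 lt_nth} => [|x B] // /andP[/eqP].
have mem i : i <= k -> nth 0 A i \in A by move=> ik; rewrite mem_nth ?hsize.
have Acase x : x \in A ->
    [\/ x = 1, x = nth 0 A 1, x = nth 0 A 2 | nth 0 A 3 <= x].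
  move=> xA; rewrite -(nth_index 0 xA); have := xA; rewrite -index_mem hsize ltnS.
  case: (index x A) => [|[|[|[|i]]]] ik.
  - by constructor 1.
  - by constructor 2.
  - by constructor 3.
  - by constructor 4.
  - by constructor 4; apply/ltnW/lt_nth.
have a1 : 1 < nth 0 A 1 by rewrite -A0; apply: lt_nth; arith.
have te : nth 0 A 3 < nth 0 A l by apply: lt_nth.
have aA : nth 0 A 1 \in A by apply: mem; arith.
have bA : nth 0 A 2 \in A by apply: mem; arith.
have tA : nth 0 A 3 \in A by apply: mem; arith.
have eA : nth 0 A l \in A by apply: mem.
move: (nth 0 A 1) (nth 0 A 2) (nth 0 A 3) (nth 0 A l)
  h2 h3 Acase a1 te aA bA tA eA => a b t e ab bt Acase a1 te aA bA tA eA.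
have gap := @orderly_gap A a b t hcur hord aA bA tA a1 ab bt Acase.
have multiple x m : x \in A -> grd A (m * x) <= m.
  move=> xA; have /(orderlyP A hcur)/(_ (nseq m x)) := hord.
  rewrite sumn_nseq size_nseq mulnC; apply.
  by move=> y; rewrite mem_nseq => /andP[_ /eqP->].
have ceil x y : 0 < x -> exists m, y <= m * x /\ m * x < y + x.
  move=> x0; exists ((y + x.-1) %/ x).
  by have := divn_eq (y + x.-1) x; have := ltn_pmod (y + x.-1) x0; arith.
have cur1 : currency [:: 1] by [].
have cur2 : currency [:: 1; a] by rewrite /currency /= a1.
have cur3 : currency [:: 1; a; b] by rewrite /currency /= a1 /=; arith.
have cur4 : currency [:: 1; a; b; e] by rewrite /currency /= a1 /=; arith.
have ord1 : orderly [:: 1].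
  apply/(orderlyP _ cur1) => s sA.
  have max1 x : x \in [:: 1] -> x <= 1 by rewrite inE => /eqP->.
  have := grd_addl_max _ 1 0 cur1 (mem_head _ _) max1 (sumn s).
  rewrite muln1 !addn0 => ->; elim: s sA => //= x s IH sA.
  rewrite -add1n leq_add ?max1 ?sA ?mem_head // IH // => y ys.
  by rewrite sA // inE ys orbT.
(* The multiple [a * 1] hits [a] exactly, so the remainder costs 0 coins. *)
have ord2 : orderly [:: 1; a].
  apply: (@orderly_rcons [:: 1] 1 a a) => //.
  - by move=> x; rewrite inE => /eqP->.
  - by rewrite muln1.
  - by rewrite muln1 subnn; apply: ltnW.
have ord3 : orderly [:: 1; a; b].
  have [m [bm mb]] := ceil a b (ltnW a1).
  apply: (@orderly_rcons [:: 1; a] a b m) => //; first by rewrite !inE eqxx orbT.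
  - by move=> x; rewrite !inE => /orP[]/eqP->; arith.
  - by arith.
  (* Since [m * a < b + a < t], greedy in [A] takes [b] first; the rest is below [a], where [A] and
     [[:: 1; a]] have the same coins. *)
  have := multiple a m aA.
  rewrite (grd_max_coin _ hcur _ b) //.
    rewrite (@grd_eq_mem A [:: 1; a]) // => x xc; apply/idP/idP.
      by move=> /Acase[->|->|?|?]; rewrite ?inE ?eqxx ?orbT //; arith.
    by rewrite !inE => /orP[]/eqP-> //; apply: currency_mem1.
  by move=> y /Acase[]; arith.
have [m [em me]] := ceil b e (leq_ltn_trans (leq0n _) ab).
apply: (@orderly_rcons [:: 1; a; b] b e m) => //; first by rewrite !inE eqxx !orbT.
- by move=> x; rewrite !inE => /or3P[]/eqP->; arith.
- by arith.
have := multiple b m bA.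
rewrite (grd_max_coin _ hcur _ e) //.
  rewrite (@grd_eq_mem A [:: 1; a; b]) // => x xc; apply/idP/idP.
    by move=> /Acase[->|->|->|?]; rewrite ?inE ?eqxx ?orbT //; arith.
  by rewrite !inE => /or3P[]/eqP-> //; apply: currency_mem1.
(* The next coin after [e] is at least [e + (t - b) > e + b > m * b]. *)
move=> y yA ym; rewrite leqNgt; apply/negP => ey.
by have := gap e y eA yA (ltnW te) ey; arith.
Qed.
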